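(* Let $\mathcal G=(V,E)$ be a connected undirected block graph, let $v\in V$, and let $C_1,\dots,C_N$ be its maximal cliques, ordered so that the running intersection property holds and $v\in C_1$, with singleton separators $S_2,\dots,S_N$ and $S_1:=\{v\}$. Let $\boldsymbol X_E$ be a graphical model relative to $\mathcal G$. If $\boldsymbol X_E$ satisfies Assumptions $A_0$ and $B_1$ (stated in the context), then as $t\to\infty$, $$\left(\frac{\boldsymbol X_{E,C_i\setminus S_i}-\boldsymbol a^{(S_i)}_{C_i\setminus S_i}(X_{E,S_i})}{\boldsymbol b^{(S_i)}_{C_i\setminus S_i}(X_{E,S_i})}\,:\,i=1,\dots,N\right)\ \bigg|\ \{X_{E,S_1}>t\}\ \overset{d}{\longrightarrow}\ \left(\boldsymbol Z^{(S_i)}_{C_i\setminus S_i}\,:\,i=1,\dots,N\right),$$ where $\boldsymbol Z^{(S_i)}_{C_i\setminus S_i}\sim G^{(S_i)}_{C_i\setminus S_i}$ for each $i$, and $\boldsymbol Z^{(S_i)}_{C_i\setminus S_i}$ is independent of $\boldsymbol Z^{(S_j)}_{C_j\setminus S_j}$ for $i\neq j$.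
   Context: **Notation.** $V=\{1,\dots,d\}$. For $A\subseteq V$, $\boldsymbol x_A=(x_u:u\in A)$; $C\setminus u$ means $C\setminus\{u\}$; $|A|$ is the cardinality of $A$; $\boldsymbol1_k$ is the vector of ones in $\mathbb R^k$. Operations and inequalities on vectors are componentwise. A singleton separator $S_i=\{s_i\}$ is identified with its element, so $X_{E,S_i}=X_{E,s_i}$, $\boldsymbol a^{(S_i)}_{C_i\setminus S_i}=\boldsymbol a^{(s_i)}_{C_i\setminus s_i}$, etc. $\overset{d}{\to}$ is convergence in distribution. $\mathbb R_+$ denotes non-negative reals; scale functions $\boldsymbol b$, by which one divides, have positive components. **Graphs.** Graphs are finite, undirected, without loops or parallel edges. A graph is decomposable (chordal) if every cycle of length at least four has an edge joining two non-consecutive vertices of the cycle. The maximal cliques of a connected chordal graph can be ordered as $C_1,\dots,C_N$ so that the running intersection property holds: for $i=2,\dots,N$, $S_i:=C_i\cap\big(\bigcup_{j=1}^{i-1}C_j\big)\subset C_k$ for some $k<i$. The first clique may be chosen arbitrarily. A connected chordal graph is a block graph if $|S_i|=1$ for all $i=2,\dots,N$. **Graphical model.** $\boldsymbol X_E$ is a graphical model relative to $\mathcal G$ if it satisfies the pairwise Markov property ($X_{E,i}$ and $X_{E,j}$ are conditionally independent given $\boldsymbol X_{E,V\setminus\{i,j\}}$ for all $i\neq j$ with $(i,j)\notin E$), and its law is described by Markov transition kernels $\mathbb P(\boldsymbol X_{E,C_i\setminus S_i}\in\cdot\mid\boldsymbol X_{E,S_i}=\boldsymbol x_{S_i})$,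 in the sense that for $i=2,\dots,N$ the conditional law of $\boldsymbol X_{E,C_i\setminus S_i}$ given $\boldsymbol X_{E,C_1\cup\dots\cup C_{i-1}}$ equals its conditional law given $\boldsymbol X_{E,S_i}$. Conditional probabilities given point values refer to these kernels (regular conditional distributions). **Assumption $A_0$.** All marginals are unit exponential: $\mathbb P(X_{E,u}\le x)=(1-e^{-x})_+$ for all $u\in V$. **Assumption $B_1$.** For every maximal clique $C_i$ and every vertex $v_i\in C_i$ there exist measurable functions $\boldsymbol a^{(v_i)}_{C_i\setminus v_i}:\mathbb R\to\mathbb R^{|C_i|-1}$ and $\boldsymbol b^{(v_i)}_{C_i\setminus v_i}:\mathbb R\to\mathbb R_+^{|C_i|-1}$ such that $\boldsymbol a^{(v_i)}_{C_i\setminus v_i}(t)+\boldsymbol b^{(v_i)}_{C_i\setminus v_i}(t)\,\boldsymbol y\to\infty\,\boldsymbol 1_{|C_i|-1}$ as $t\to\infty$ for all $\boldsymbol y\in\mathbb R^{|C_i|-1}$, and a distribution function $G^{(v_i)}_{C_i\setminus v_i}$ supported on $\mathbb R^{|C_i|-1}$ with non-degenerate marginal distributions, such that as $t\to\infty$ the conditional distribution $$\mathbb P\left(\frac{\boldsymbol X_{E,C_i\setminus v_i}-\boldsymbol a^{(v_i)}_{C_i\setminus v_i}(X_{E,v_i})}{\boldsymbol b^{(v_i)}_{C_i\setminus v_i}(X_{E,v_i})}\le\boldsymbol z_{C_i\setminus v_i}\ \Big|\ X_{E,v_i}=t\right)$$ converges weakly to $G^{(v_i)}_{C_i\setminus v_i}(\boldsymbol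 z_{C_i\setminus v_i})$. *)

(* Defs.v *)
From HB Require Import structures.
From mathcomp Require Export all_boot all_order all_algebra.
From mathcomp Require Export all_classical all_reals all_analysis.
From mathcomp Require Export measurable_realfun.

Set Implicit Arguments.
Unset Strict Implicit.
Unset Printing Implicit Defensive.

Import Order.TTheory GRing.Theory Num.Theory.
Import numFieldNormedType.Exports.

Local Open Scope classical_set_scope.
Local Open Scope ring_scope.

Section rvec.
Variables (R : realType) (T : finType).

(* R^T, with the product topology and the product sigma-algebra, which is the
   Borel sigma-algebra since T is finite. *)
Definition rvec : Type := {ptws T -> R}.

HB.instance Definition _ := Topological.copy rvec {ptws T -> R}.
HB.instance Definition _ := Pointed.copy rvec {ptws T -> R}.

Definition rvec_salgebra : set (set rvec) :=
  <<s \bigcup_i preimage_set_system [set: rvec] (fun y : rvec => y i)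
        measurable >>.

Let rvec_set0 : rvec_salgebra set0.
Proof. exact: sigma_algebra0. Qed.

Let rvec_setC A : rvec_salgebra A -> rvec_salgebra (~` A).
Proof. exact: sigma_algebraC. Qed.

Let rvec_bigcup (F : _^nat) :
  (forall i, rvec_salgebra (F i)) -> rvec_salgebra (\bigcup_i (F i)).
Proof. exact: sigma_algebra_bigcup. Qed.

Definition rvec_display : measure_display.
Proof. exact: default_measure_display. Qed.

HB.instance Definition _ := @isMeasurable.Build rvec_display rvec
  rvec_salgebra rvec_set0 rvec_setC rvec_bigcup.

(* The multivariate distribution function of the law mu. *)
Definition mcdf (mu : set rvec -> \bar R) (z : rvec) : R :=
  fine (mu [set y | forall i, y i <= z i]).

(* Weak convergence of distribution functions as t tends to +oo: pointwise
   convergence at the continuity points of the limit. *)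
Definition weakly_cvg (F : R -> rvec -> R) (H : rvec -> R) : Prop :=
  forall z : rvec, {for z, continuous H} -> F t z @[t --> +oo] --> H z.

Definition nondegenerate_marginals (mu : set rvec -> \bar R) : Prop :=
  forall (i : T) (c : R), mu [set y | y i = c] != 1%E.

End rvec.

(* R^A for a set A of vertices, with coordinates indexed by the members of A. *)
Notation subvec R A := (rvec R {u : _ | u \in A%SET}).

Section conditioning.
Context d (Omega : measurableType d) (R : realType) (P : probability Omega R).

Definition sigma_gen d1 (T1 : measurableType d1) (Y : Omega -> T1) :
  set (set Omega) := preimage_set_system [set: Omega] Y measurable.

(* f is a version of the conditional probability of the event A given the
   sub-sigma-algebra F. *)
Definition cond_prob (F : set (set Omega)) (A : set Omega)
    (f : Omega -> \bar R) : Prop :=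
  [/\ forall U : set (\bar R), measurable U -> F (f @^-1` U),
      forall w, (0 <= f w)%E
    & forall D, F D -> (\int[P]_(w in D) f w = P (A `&` D))%E].

(* k is a version of the regular conditional distribution of W given F. *)
Definition cond_law (F : set (set Omega)) d1 (T1 : measurableType d1)
    (W : Omega -> T1) (k : Omega -> {measure set T1 -> \bar R}) : Prop :=
  forall B, measurable B -> cond_prob F (W @^-1` B) (fun w => k w B).

Definition cond_indep d1 d2 (T1 : measurableType d1) (T2 : measurableType d2)
    (Y1 : Omega -> T1) (Y2 : Omega -> T2) (F : set (set Omega)) : Prop :=
  forall B1 B2, measurable B1 -> measurable B2 ->
  exists f1 f2 : Omega -> \bar R,
    [/\ cond_prob F (Y1 @^-1` B1) f1,
        cond_prob F (Y2 @^-1` B2) f2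
      & cond_prob F (Y1 @^-1` B1 `&` Y2 @^-1` B2) (fun w => f1 w * f2 w)%E].

Definition mutual_indep (I : finType) d1 (T1 : I -> measurableType d1)
    (Z : forall i, Omega -> T1 i) : Prop :=
  forall (J : {set I}) (B : forall i, set (T1 i)),
    (forall i, measurable (B i)) ->
    P [set w | forall i, i \in J -> B i (Z i w)] =
    (\prod_(i in J) P (Z i @^-1` B i))%E.

(* The distribution function of W under P( . | E). *)
Definition cond_cdf (E : set Omega) (T : finType) (W : Omega -> rvec R T)
    (z : rvec R T) : R :=
  fine (P ([set w | forall i, W w i <= z i] `&` E)) / fine (P E).

End conditioning.

Section graphs.
Variables (d : nat) (e : rel 'I_d).

Definition clique (A : {set 'I_d}) : bool :=
  [forall x in A, forall y in A, (x != y) ==> e x y].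

Definition max_clique (A : {set 'I_d}) : bool := maxset clique A.

Definition graph_connected : Prop := forall x y, connect e x y.

Definition chordal : Prop :=
  forall c : seq 'I_d, (4 <= size c)%N -> ucycle e c ->
  exists x y, [/\ x \in c, y \in c, e x y, y != next c x & x != next c y].

(* The numbering of the cliques starts at ord0. *)
Definition predecessors n (C : 'I_n.+1 -> {set 'I_d}) (i : 'I_n.+1) :
  {set 'I_d} := (\bigcup_(j : 'I_n.+1 | (j < i)%N) C j)%SET.

Definition separator n (C : 'I_n.+1 -> {set 'I_d}) (i : 'I_n.+1) :
  {set 'I_d} := C i :&: predecessors C i.

Definition rip_ordering n (C : 'I_n.+1 -> {set 'I_d}) : Prop :=
  [/\ injective C,
      forall A, max_clique A <-> exists i, C i = A
    & forall i, i != ord0 ->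
        exists2 k : 'I_n.+1, (k < i)%N & separator C i \subset C k].

(* The family of separators does not depend on the ordering chosen, up to
   reindexing. *)
Definition block_graph : Prop :=
  [/\ graph_connected, chordal
    & forall n (C : 'I_n.+1 -> {set 'I_d}), rip_ordering C ->
        forall i, i != ord0 -> #|separator C i| = 1%N].

End graphs.

Section model.
Context disp (Omega : measurableType disp) (R : realType).
Variable P : probability Omega R.
Variables (d : nat) (e : rel 'I_d) (X : 'I_d -> {RV P >-> R}).

Definition coords (A : {set 'I_d}) (w : Omega) : subvec R A :=
  fun u => X (val u) w.
Arguments coords : clear implicits.

Definition pairwise_markov : Prop :=
  forall i j : 'I_d, i != j -> ~~ e i j ->
  cond_indep P (X i) (X j) (sigma_gen (coords (~: [set i; j])%SET)).

(* K A u x stands for the conditional law of X_{A \ u} given X_u = x. *)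
Definition kernels : Type :=
  forall (A : {set 'I_d}) (u : 'I_d),
    R.-pker (measurableTypeR R) ~> subvec R (A :\ u).

Definition transition_kernels (K : kernels) : Prop :=
  forall A u, max_clique e A -> u \in A ->
  cond_law P (sigma_gen (X u)) (coords (A :\ u)) (fun w => K A u (X u w)).

(* s i is the element of the singleton separator S_i, and the kernels of the
   model are read off from K. *)
Definition graphical_model (K : kernels) n (C : 'I_n.+1 -> {set 'I_d})
    (s : 'I_n.+1 -> 'I_d) : Prop :=
  pairwise_markov /\
  forall i, i != ord0 ->
    cond_law P (sigma_gen (X (s i))) (coords (C i :\ s i))
      (fun w => K (C i) (s i) (X (s i) w)) /\
    cond_law P (sigma_gen (coords (predecessors C i))) (coords (C i :\ s i))
      (fun w => K (C i) (s i) (X (s i) w)).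

Definition assumption_A0 : Prop :=
  forall u x, P [set w | X u w <= x] = (Num.max 0 (1 - expR (- x)))%:E.

Definition normings : Type :=
  forall (A : {set 'I_d}) (u : 'I_d), R -> subvec R (A :\ u).

(* G A u is the law on R^(A \ u) whose distribution function is the limit. *)
Definition assumption_B1 (K : kernels) (a b : normings)
    (G : forall A u, probability (subvec R (A :\ u)) R) : Prop :=
  forall A u, max_clique e A -> u \in A ->
  [/\ measurable_fun [set: R] (a A u) /\ measurable_fun [set: R] (b A u),
      forall t w, 0 < b A u t w,
      forall (y : subvec R (A :\ u)) w,
        a A u t w + b A u t w * y w @[t --> +oo] --> +oo,
      nondegenerate_marginals (G A u)
    & weakly_cvg
        (fun t z => fine (K A u t
           [set y | forall w, (y w - a A u t w) / b A u t w <= z w]))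
        (mcdf (G A u))].

(* The concatenation over i of the renormalised vectors
   (X_{C_i \ s_i} - a(X_{s_i})) / b(X_{s_i}). *)
Definition normalised (a b : normings) n (C : 'I_n.+1 -> {set 'I_d})
    (s : 'I_n.+1 -> 'I_d) (w : Omega) :
    rvec R {i : 'I_n.+1 & {u : 'I_d | u \in C i :\ s i}} :=
  fun p => let: existT i u := p in
    (X (val u) w - a (C i) (s i) (X (s i) w) u) / b (C i) (s i) (X (s i) w) u.

End model.

Arguments coords {disp Omega R P d} X A w.
Arguments normalised {disp Omega R P d} X a b {n} C s w.

Definition concat (R : realType) (I : finType) (T : I -> finType)
    (z : forall i, rvec R (T i)) : rvec R {i : I & T i} :=
  fun p => z (tag p) (tagged p).

(* Main.v *)
(* Write Q_t for the conditional probability given {X_v > t}, and E_i for the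
   event that the i-th renormalised block is below z_i.  Given the cliques
   C_1, ..., C_(i-1), the block i has law K_i(X_(s_i)), so Q_t(E_1 & ... & E_i)
   is the integral of k_i(X_(s_i)) over E_1 & ... & E_(i-1), where k_i(x), the
   probability of E_i when X_(s_i) = x, tends to G_i(z_i) as x -> +oo.  Hence
   Q_t(E_1 & ... & E_i) - G_i(z_i) Q_t(E_1 & ... & E_(i-1)) -> 0 as soon as
   Q_t(X_(s_i) <= M) -> 0 for every M, and the limit is a product by induction.
   That every X_u escapes to +oo follows by a similar induction along the
   cliques: the limit of the renormalised kernels is a probability measure,
   hence tight, and a + b y -> +oo for every y. *)

Require Import Defs.
From mathcomp Require Import lra.

Set Implicit Arguments.
Unset Strict Implicit.
Unset Printing Implicit Defensive.

Import Order.TTheory GRing.Theory Num.Theory.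
Import numFieldNormedType.Exports.

Local Open Scope classical_set_scope.
Local Open Scope ring_scope.

(** * Distribution functions and their continuity points *)

Lemma measurable_rvec_proj (R : realType) (T : finType) (i : T) :
  measurable_fun [set: rvec R T] (fun y : rvec R T => y i).
Proof.
move=> _ B mB; apply: sub_sigma_algebra.
by exists i => //; exists B.
Qed.

Lemma measurable_fun_rvec d (S : measurableType d) (R : realType) (T : finType)
    (f : S -> rvec R T) :
  (forall i, measurable_fun [set: S] (fun w => f w i)) ->
  measurable_fun [set: S] f.
Proof.
move=> mf; apply: (@measurability _ _ _ _ setT f _ erefl).
move=> _ [_ [i _ [B mB <-]] <-].
by rewrite !setTI -comp_preimage -(setTI (_ @^-1` _)); exact: mf.
Qed.

Lemma measurable_rvec_le d (S : measurableType d) (R : realType) (T : finType)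
    (f g : S -> rvec R T) :
  (forall i, measurable_fun [set: S] (fun w => f w i)) ->
  (forall i, measurable_fun [set: S] (fun w => g w i)) ->
  measurable [set w | forall i, f w i <= g w i].
Proof.
move=> mf mg.
have -> : [set w | forall i, f w i <= g w i] =
    \bigcap_(i in [set: T]) [set w | f w i <= g w i].
  by apply/seteqP; split=> [w h i _|w h i]; exact: h.
apply: fin_bigcap_measurable => // i _.
rewrite -[X in measurable X]setTI; exact: measurable_fun_le.
Qed.

Lemma rvec_le_measurable (R : realType) (T : finType) (z : rvec R T) :
  measurable [set y : rvec R T | forall i, y i <= z i].
Proof.
apply: measurable_rvec_le => i; first exact: measurable_rvec_proj.
exact: measurable_cst.
Qed.

(** Moving every coordinate by the same amount turns the search for continuity points of a
    multivariate distribution function into one about a monotone function of one real variable. *)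
Definition rvec_shift (R : realType) (T : finType) (z : rvec R T) (c : R) : rvec R T :=
  fun i => z i + c.

Lemma rvec_shift_continuous (R : realType) (T : finType) (z : rvec R T) :
  rvec_shift z c @[c --> 0] --> z.
Proof.
have FF : Filter (rvec_shift z c @[c --> (0:R)]) by apply: fmap_filter.
apply/cvg_sup => i; rewrite cvg_image; last first.
  by rewrite eqEsubset; split=> v // _; exists (cst v).
apply: cvg_trans (_ : (fun c => z i + c) @ 0 --> z i).
  move=> W /=; rewrite ?nbhs_simpl /= => zW.
  exists ((@^~ i) @^-1` W) => //.
  by rewrite eqEsubset; split => [j [? + <-//]|j Wj]; exists (fun _ => j).
rewrite -[X in _ --> X]addr0; apply: cvgD; [exact: cvg_cst|exact: cvg_id].
Qed.

Lemma rvec_box_nbhs (R : realType) (T : finType) (z : rvec R T) (e : R) :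
  0 < e -> \forall y \near z, forall i, `|z i - y i| < e.
Proof.
move=> e0; apply: (@filter_forall _ _ (fun i (y : rvec R T) => `|z i - y i| < e)
  (nbhs z) (nbhs_filter z)) => i.
have h : (fun y : rvec R T => y i) @ z --> z i.
  exact: (@proj_continuous T (fun=> R) i z).
by move/cvgrPdist_lt : h => /(_ _ e0).
Qed.

Lemma mcdf_fin (R : realType) (T : finType) (mu : probability (rvec R T) R) z :
  mu [set y | forall i, y i <= z i] = (mcdf mu z)%:E.
Proof. by rewrite /mcdf fineK// fin_num_measure//; exact: rvec_le_measurable. Qed.

Lemma mcdf_le (R : realType) (T : finType) (mu : probability (rvec R T) R)
    (z z' : rvec R T) : (forall i, z i <= z' i) -> mcdf mu z <= mcdf mu z'.
Proof.
move=> zz'; rewrite -lee_fin -!mcdf_fin le_measure ?inE//.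
- exact: rvec_le_measurable.
- exact: rvec_le_measurable.
- by move=> y yz i; exact: le_trans (yz i) (zz' i).
Qed.

(** Continuity along the diagonal suffices: if y is within r/2 of z in every coordinate,
    monotonicity traps the value at y between those at z - r/2 and z + r/2. *)
Lemma mcdf_continuousP (R : realType) (T : finType)
    (mu : probability (rvec R T) R) (z : rvec R T) :
  {for 0, continuous (fun c => mcdf mu (rvec_shift z c))} ->
  {for z, continuous (mcdf mu)}.
Proof.
rewrite /prop_for /continuous_at => cont.
suff : mcdf mu y @[y --> z] --> mcdf mu z by [].
apply/(@cvgrPdist_lt _ R^o _ (nbhs z) (nbhs_filter z) (mcdf mu) (mcdf mu z)) => e e0.
move/cvgrPdist_lt : cont => /(_ _ e0) /nbhs_ballP[r /= r0 hr].
have r20 : 0 < r / 2 by rewrite divr_gt0.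
have rr : r / 2 < r by rewrite ltr_pdivrMr// ltr_pMr// ltr1n.
near=> y.
have yz : forall i, `|z i - y i| < r / 2.
  by near: y; exact: rvec_box_nbhs.
have h1 : mcdf mu y <= mcdf mu (rvec_shift z (r / 2)).
  apply: mcdf_le => i; have := yz i; rewrite /rvec_shift ltr_norml => /andP[? ?]; lra.
have h2 : mcdf mu (rvec_shift z (- (r / 2))) <= mcdf mu y.
  apply: mcdf_le => i; have := yz i; rewrite /rvec_shift ltr_norml => /andP[? ?]; lra.
have := hr (r / 2); rewrite /ball/= sub0r normrN gtr0_norm//.
move=> /(_ rr); have := hr (- (r / 2)).
rewrite /ball/= sub0r opprK gtr0_norm// => /(_ rr).
have -> : rvec_shift z 0 = z by apply/funext => i; rewrite /rvec_shift addr0.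
by rewrite !ltr_norml => /andP[? ?] /andP[? ?]; apply/andP; split; lra.
Unshelve. all: by end_near. Qed.

(** Monotonicity provides both one-sided limits and squeezes g(c) between them, so a jump is the
    only possible failure of continuity. *)
Lemma nondecreasing_continuous (R : realType) (g : R -> R) (c : R) :
  {homo g : x y / x <= y} -> ~ discontinuity g c -> {for c, continuous g}.
Proof.
move=> ndg ndisc.
have cl : cvg (g x @[x --> c^'-]).
  apply: nondecreasing_at_left_is_cvgr.
    by near=> x => y z _ _; exact: ndg.
  near=> x; exists (g c) => _ /= [z + <-]; rewrite in_itv/= => /andP[_ /ltW].
  exact: ndg.
have cr : cvg (g x @[x --> c^'+]).
  apply: nondecreasing_at_right_is_cvgr.
    by near=> x => y z _ _; exact: ndg.
  near=> x; exists (g c) => _ /= [z + <-]; rewrite in_itv/= => /andP[/ltW + _].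
  exact: ndg.
have lc : lim (g x @[x --> c^'-]) <= g c.
  by apply: limr_le => //; near=> x; apply: ndg; near: x; exact: nbhs_left_le.
have cl' : g c <= lim (g x @[x --> c^'+]).
  by apply: limr_ge => //; near=> x; apply: ndg; near: x; exact: nbhs_right_ge.
have lr : lim (g x @[x --> c^'-]) = lim (g x @[x --> c^'+]).
  by apply/eqP; apply: contra_notT ndisc => lr; split.
have lE : lim (g x @[x --> c^'-]) = g c.
  by apply/eqP; rewrite eq_le lc lr.
apply/left_right_continuousP; split.
  by rewrite -lE.
by rewrite -lE lr.
Unshelve. all: by end_near. Qed.

(** Each monotone function has countably many jumps, and so do finitely many together, whereas the
    interval ]0, e[ has positive Lebesgue measure. *)
Lemma exists_common_continuity_point (R : realType) (I : finType)
    (g : I -> R -> R) (e : R) : 0 < e ->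
  (forall i, {homo g i : x y / x <= y}) ->
  exists2 c, 0 < c < e & forall i, {for c, continuous (g i)}.
Proof.
move=> e0 ndg.
pose D := \bigcup_(i in [set: I])
  [set x | x \in (`]0, e[) /\ discontinuity (g i) x].
have cD : countable D.
  apply: bigcup_countable => [|i _]; first exact: finite_set_countable.
  by apply: discontinuity_countable => x y _ _; exact: ndg.
have : ~ ([set` `]0, e[] `<=` D).
  move=> eD; have := sub_countable (subset_card_le eD) cD.
  move=> /countable_lebesgue_measure0/eqP.
  rewrite lebesgue_measure_itv/= lte_fin e0 sube0 eqe.
  by rewrite gt_eqF.
move=> /existsNP[c /not_implyP[ce nD]].
exists c; first by move: ce; rewrite /= in_itv.
move=> i; apply: nondecreasing_continuous => // dc.
by apply: nD; exists i.
Qed.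

Lemma mcdf_common_continuity_point (R : realType) (I : finType)
    (T : I -> finType) (mu : forall i, probability (rvec R (T i)) R)
    (z : forall i, rvec R (T i)) (e : R) : 0 < e ->
  exists2 c, 0 < c < e & forall i, {for rvec_shift (z i) c, continuous (mcdf (mu i))}.
Proof.
move=> e0.
have [|c ce hc] := @exists_common_continuity_point R I
    (fun i x => mcdf (mu i) (rvec_shift (z i) x)) e e0.
  by move=> i x y xy; apply: mcdf_le => j; rewrite lerD2l.
exists c => // i; apply: mcdf_continuousP.
(* Continuity at 0 of the diagonal section through the shifted point is continuity at c of the
   section through [z i]. *)
have cE : (fun x => mcdf (mu i) (rvec_shift (rvec_shift (z i) c) x)) =
  (fun x => mcdf (mu i) (rvec_shift (z i) x)) \o (fun x => c + x).
  by apply/funext => x /=; congr mcdf; apply/funext => j; rewrite /rvec_shift addrA.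
rewrite cE; apply: continuous_comp; last by rewrite addr0; exact: hc.
by apply: cvgD; [exact: cvg_cst|exact: cvg_id].
Qed.

(* The distribution function of a product may be continuous at z while a factor
   is not continuous at z_i, namely when another factor vanishes, so it is
   sandwiched between its values at nearby points where all factors are
   continuous. *)
Lemma weakly_cvg_shift (R : realType) (T : finType) (F : R -> rvec R T -> R)
    (H : rvec R T -> R) :
  (forall t (z z' : rvec R T), (forall i, z i <= z' i) -> F t z <= F t z') ->
  (forall z (r : R), 0 < r -> exists2 c, 0 < c < r &
     F t (rvec_shift z c) @[t --> +oo] --> H (rvec_shift z c)) ->
  weakly_cvg F H.
Proof.
move=> F_le FH z Hz.
apply/cvgrPdist_le => e e0.
have e20 : 0 < e / 2 by rewrite divr_gt0.
have Hz0 : H (rvec_shift z c) @[c --> (0 : R)] --> H z.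
  exact: cvg_comp (@rvec_shift_continuous R T z) Hz.
move/cvgrPdist_le : Hz0 => /(_ _ e20) /nbhs_ballP[r /= r0 hr].
have [c /andP[c0 cr] Fc] := FH z r r0.
(* The corner below z is reached from z - r: a further shift by c' in ]0, r[ gives the total shift
   c' - r, which lies in ]-r, 0[. *)
have [c' /andP[c'0 c'r] Fc'] := FH (rvec_shift z (- r)) r r0.
have zc' : rvec_shift (rvec_shift z (- r)) c' = rvec_shift z (c' - r).
  by apply/funext => i; rewrite /rvec_shift addrA addrAC.
rewrite zc' in Fc'.
have := hr c; rewrite /ball/= sub0r normrN gtr0_norm// => /(_ cr) Hc.
have := hr (c' - r); rewrite /ball/= sub0r normrN ltr0_norm ?subr_lt0// opprB.
rewrite ltrBlDr ltrDl c'0 => /(_ isT) Hc'.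
move/cvgrPdist_le : Fc => /(_ _ e20) Fc; move/cvgrPdist_le : Fc' => /(_ _ e20) Fc'.
near=> t.
have h1 : F t z <= F t (rvec_shift z c) by apply: F_le => i; rewrite lerDl ltW.
have h2 : F t (rvec_shift z (c' - r)) <= F t z.
  by apply: F_le => i; rewrite gerDl subr_le0 ltW.
have h3 : `|H (rvec_shift z c) - F t (rvec_shift z c)| <= e / 2 by near: t; exact: Fc.
have h4 : `|H (rvec_shift z (c' - r)) - F t (rvec_shift z (c' - r))| <= e / 2.
  by near: t; exact: Fc'.
move: Hc Hc' h3 h4; rewrite !ler_norml.
move=> /andP[? ?] /andP[? ?] /andP[? ?] /andP[? ?]; apply/andP; split; lra.
Unshelve. all: by end_near. Qed.

(** * Disintegration *)

Section disintegration.
Context d (Omega : measurableType d) (R : realType) (P : probability Omega R).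
Context d1 (T1 : measurableType d1) d2 (T2 : measurableType d2).
Variables (K : R.-pker T1 ~> T2) (Y : Omega -> T1) (W : Omega -> T2).
Hypotheses (mY : measurable_fun [set: Omega] Y)
  (mW : measurable_fun [set: Omega] W).

Lemma measurable_kernel_section (S : set (T1 * T2)) : measurable S ->
  measurable_fun [set: Omega] (fun w => K (Y w) (xsection S (Y w))).
Proof.
move=> mS; apply: (@measurableT_comp _ _ _ _ _ _ (fun x => K x (xsection S x))) mY.
by apply: measurable_fun_xsection_finite_kernel; rewrite inE.
Qed.

(** Both sides are finite measures in S, so by Dynkin's theorem it is enough that they agree on
    rectangles. Joint events in (Y, W) are needed because the norming functions are evaluated at the
    random conditioning value. *)
Lemma integral_kernel_section (D : set Omega) :
  measurable D ->
  (forall A B, measurable A -> measurable B ->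
    P (W @^-1` B `&` (D `&` Y @^-1` A)) =
    \int[P]_(w in D `&` Y @^-1` A) K (Y w) B)%E ->
  forall S, measurable S ->
    P ((fun w => (Y w, W w)) @^-1` S `&` D) =
    (\int[P]_(w in D) K (Y w) (xsection S (Y w)))%E.
Proof.
move=> mD PDE.
have mYW : measurable_fun [set: Omega] (fun w => (Y w, W w)).
  exact: measurable_fun_pair.
have mYWS S : measurable S -> measurable ((fun w => (Y w, W w)) @^-1` S).
  by move=> mS; rewrite -[X in measurable X]setTI; exact: mYW.
pose G := [set A `*` B | A in (@measurable _ T1) & B in (@measurable _ T2)].
pose Q (S : set (T1 * T2)) := P ((fun w => (Y w, W w)) @^-1` S `&` D) =
    (\int[P]_(w in D) K (Y w) (xsection S (Y w)))%E.
have GQ A B : measurable A -> measurable B -> Q (A `*` B).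
  move=> mA mB; rewrite /Q.
  have -> : (fun w => (Y w, W w)) @^-1` (A `*` B) `&` D =
      W @^-1` B `&` (D `&` Y @^-1` A).
    by apply/seteqP; split => w /=; tauto.
  rewrite PDE// integral_mkcondr; apply: eq_integral => w _.
  rewrite patchE; have -> : (w \in Y @^-1` A) = (Y w \in A) by apply/idP/idP; rewrite !inE.
  have [YA|YA] := boolP (Y w \in A); first by rewrite in_xsectionX.
  by rewrite notin_xsectionX// measure0.
move=> S mS; apply: (@dynkin_induction _ _ G Q) => //.
- by rewrite measurable_prod_measurableType.
- move=> _ _ [A1 mA1 [B1 mB1 <-]] [A2 mA2 [B2 mB2 <-]].
  exists (A1 `&` A2); first exact: measurableI.
  by exists (B1 `&` B2); [exact: measurableI|rewrite setXI].
- by rewrite -setXTT; exact: GQ.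
- by move=> _ [A mA [B mB <-]]; exact: GQ.
(* Complements: on either side the values at S and at its complement add up to P D, which is finite,
   so the equality for S can be subtracted. *)
- move=> {}S {}mS QS; rewrite /Q.
  have PD : (P ((fun w => (Y w, W w)) @^-1` S `&` D) +
      P ((fun w => (Y w, W w)) @^-1` (~` S) `&` D) = P D)%E.
    rewrite -measureU; last 3 first.
    + by apply: measurableI => //; exact: mYWS.
    + by apply: measurableI => //; apply: mYWS; exact: measurableC.
    + by rewrite -subset0 => w [] [] /= ? _ [].
    by rewrite -setIUl -preimage_setU setUv preimage_setT setTI.
  have ID : ((\int[P]_(w in D) K (Y w) (xsection S (Y w))) +
      (\int[P]_(w in D) K (Y w) (xsection (~` S) (Y w))) = P D)%E.
    rewrite -ge0_integralD//; last 2 first.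
    + by apply: measurable_funTS; exact: measurable_kernel_section.
    + by apply: measurable_funTS; apply: measurable_kernel_section; exact: measurableC.
    rewrite -[RHS]mul1e -integral_cst//; apply: eq_integral => w _.
    rewrite -measureU; last 3 first.
    + exact: measurable_xsection.
    + by apply: measurable_xsection; exact: measurableC.
    + by rewrite -xsectionI setICr xsection0.
    by rewrite !xsectionE -preimage_setU setUv preimage_setT; exact: prob_kernel.
  have Sfin : P ((fun w => (Y w, W w)) @^-1` S `&` D) \is a fin_num.
    by rewrite fin_num_measure//; apply: measurableI => //; exact: mYWS.
  rewrite -[LHS](addeK _ Sfin) addeC -[RHS](addeK _ Sfin) [RHS]addeC; congr (_ + _)%E.
  by rewrite addeC PD -ID addeC QS.
- move=> F mF tF QF; rewrite /Q preimage_bigcup setI_bigcupl.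
  rewrite measure_semi_bigcup//; last 3 first.
  + by move=> k; apply: measurableI => //; exact: mYWS.
  + apply/trivIsetP => i j _ _ ij; move/trivIsetP : tF => /(_ i j I I ij) Fij.
    by rewrite setIACA setIid -preimage_setI Fij preimage_set0 set0I.
  + by apply: bigcup_measurable => k _; apply: measurableI => //; exact: mYWS.
  (* Disjoint unions: sum and integral are interchanged for nonnegative terms. *)
  transitivity (\int[P]_(w in D) \sum_(k <oo) K (Y w) (xsection (F k) (Y w)))%E.
    rewrite integral_nneseries//; last first.
      by move=> k; apply: measurable_funTS; exact: measurable_kernel_section.
    by apply: eq_eseriesr => k _; exact: QF.
  apply: eq_integral => w _; rewrite xsection_bigcup measure_semi_bigcup//.
  + by move=> k; exact: measurable_xsection.
  + exact: trivIset_xsection.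
  + by apply: bigcup_measurable => k _; exact: measurable_xsection.
- by rewrite -measurable_prod_measurableType.
Qed.

End disintegration.

(** * Conditioning on a rare event *)

Section conditioning_step.
Context d (Omega : measurableType d) (R : realType) (P : probability Omega R).

Definition condp (B A : set Omega) : R := fine (P (A `&` B)) / fine (P B).

Lemma condp_ge0 B A : 0 <= condp B A.
Proof. by rewrite divr_ge0// fine_ge0. Qed.

Lemma condp_le B A A' : measurable A -> measurable A' -> measurable B ->
  A `<=` A' -> condp B A <= condp B A'.
Proof.
move=> mA mA' mB AA'; rewrite ler_wpM2r ?invr_ge0 ?fine_ge0// fine_le//.
- by rewrite fin_num_measure//; exact: measurableI.
- by rewrite fin_num_measure//; exact: measurableI.
- by rewrite le_measure// ?inE; [exact: measurableI|exact: measurableI|exact: setSI].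
Qed.

(** The integrand phi is within e of l where Y > M, and within 1 of it elsewhere since both lie in
    [0, 1]. Integrating over D and B and dividing by P B gives the bound. *)
Lemma condp_kernel_dist (B E D : set Omega) (phi : Omega -> \bar R) (Y : Omega -> R)
    (l e M : R) : measurable B -> measurable E -> measurable D ->
  (0 < P B)%E -> measurable_fun [set: Omega] phi ->
  measurable_fun [set: Omega] Y ->
  (forall w, 0 <= phi w <= 1)%E -> 0 <= l <= 1 -> 0 <= e ->
  (forall w, M < Y w -> `|l - fine (phi w)| <= e) ->
  P (E `&` (D `&` B)) = (\int[P]_(w in D `&` B) phi w)%E ->
  `|l * condp B D - condp B (E `&` D)| <= e + condp B [set w | Y w <= M].
Proof.
move=> mB mE mD PB0 mphi mY phi01 l01 e0 phil PE.
have mDB : measurable (D `&` B) by exact: measurableI.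
pose N := [set w | Y w <= M].
have mN : measurable N.
  by rewrite -[X in measurable X]setTI; apply: measurable_fun_le => //; exact: measurable_cst.
have PBfin : P B \is a fin_num by rewrite fin_num_measure.
pose pD := fine (P (D `&` B)); pose pE := fine (P (E `&` (D `&` B))).
pose pN := fine (P (N `&` B)); pose pB := fine (P B).
have pB0 : 0 < pB by rewrite fine_gt0// PB0 ltey_eq PBfin.
have PD : P (D `&` B) = pD%:E by rewrite fineK// fin_num_measure.
have PEE : P (E `&` (D `&` B)) = pE%:E.
  by rewrite fineK// fin_num_measure//; exact: measurableI.
have PN : P (N `&` B) = pN%:E.
  by rewrite fineK// fin_num_measure//; exact: measurableI.
have PNDB : (\int[P]_(w in D `&` B) (\1_N w)%:E <= pN%:E)%E.
  rewrite integral_indic// -PN le_measure ?inE//.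
  - exact: measurableI.
  - exact: measurableI.
  - by move=> w [? []].
have pDB : pD <= pB.
  by rewrite fine_le// ?PD//; rewrite -PD le_measure ?inE//; exact: subIsetr.
have phifin w : (fine (phi w))%:E = phi w.
  rewrite fineK// ge0_fin_numE.
    by have /andP[_ /le_lt_trans->] := phi01 w; rewrite ?ltry.
  by case/andP : (phi01 w).
(* The indicator of Y <= M absorbs the region where nothing is known about phi. *)
have key w : l <= fine (phi w) + e + \1_N w /\ fine (phi w) <= l + e + \1_N w.
  have [p0 p1] : 0 <= fine (phi w) /\ fine (phi w) <= 1.
    by have /andP[] := phi01 w; rewrite -phifin !lee_fin.
  have [YM|YM] := leP (Y w) M.
    rewrite indicE mem_set//=; move: l01 => /andP[? ?]; split; lra.
  rewrite indicE memNset/=; last by move=> /=; apply/negP; rewrite -ltNge.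
  have := phil w YM; rewrite ler_norml => /andP[? ?]; split; lra.
have mindicN : measurable_fun (D `&` B) (fun w => (\1_N w)%:E : \bar R).
  by apply/measurable_EFinP; exact: measurable_indic.
(* The two sides of the absolute value are treated separately, so that only nonnegative functions
   are integrated. *)
have i1 : l * pD <= pE + e * pD + pN.
  rewrite -lee_fin EFinM -PD -integral_cst//.
  apply: (@le_trans _ _ (\int[P]_(w in D `&` B) ((phi w + e%:E) + ((\1_N w : R)%R)%:E))%E).
    apply: ge0_le_integral => //.
    - by move=> w _; rewrite lee_fin; case/andP: l01.
    - apply: emeasurable_funD => //; apply: emeasurable_funD => //.
      exact: measurable_funTS.
    - by move=> w _; rewrite -phifin -!EFinD lee_fin; have [] := key w.
  rewrite ge0_integralD//; last 2 first.
  - by move=> w _; rewrite -phifin -!EFinD lee_fin addr_ge0// fine_ge0//; case/andP: (phi01 w).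
  - by apply: emeasurable_funD => //; exact: measurable_funTS.
  rewrite ge0_integralD//; last 2 first.
  - by move=> w _; case/andP: (phi01 w).
  - exact: measurable_funTS.
  rewrite -PE PEE integral_cst; last by [].
  by rewrite !EFinD EFinM -PD; apply: leeD.
have i2 : pE <= (l + e) * pD + pN.
  rewrite -lee_fin -PEE PE EFinD EFinM -PD -integral_cst//.
  apply: (@le_trans _ _ (\int[P]_(w in D `&` B) ((l + e)%:E + ((\1_N w : R)%R)%:E))%E).
    apply: ge0_le_integral => //.
    - by move=> w _; case/andP: (phi01 w).
    - exact: measurable_funTS.
    - by apply: emeasurable_funD.
    - by move=> w _; rewrite -phifin -!EFinD lee_fin; have [] := key w.
  rewrite ge0_integralD//; last first.
    by move=> w _; rewrite lee_fin addr_ge0//; case/andP: l01.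
  exact: leeD.
rewrite /condp -setIA -/pE -/pD -/pB -/N -/pN mulrA -mulrBl normrM normfV.
rewrite (gtr0_norm pB0) ler_pdivrMr// mulrDl divfK ?gt_eqF//.
have : e * pD <= e * pB by rewrite ler_wpM2l.
by rewrite ler_norml => ?; apply/andP; split; lra.
Qed.

(** This is the induction step of both arguments along the cliques: escape to infinity, with l = 0
    and D the whole space, and joint convergence, with D the event of the earlier blocks. *)
Lemma condp_kernel_cvg (B : R -> set Omega) (E D : set Omega)
    (phi : R -> \bar R) (Y : Omega -> R) (l q : R) :
  (forall t, measurable (B t)) -> measurable E -> measurable D ->
  (forall t, 0 < P (B t))%E ->
  measurable_fun [set: Omega] (phi \o Y) ->
  measurable_fun [set: Omega] Y ->
  (forall x, 0 <= phi x <= 1)%E -> 0 <= l <= 1 ->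
  fine (phi x) @[x --> +oo] --> l ->
  (forall M, condp (B t) [set w | Y w <= M] @[t --> +oo] --> 0) ->
  (forall t, P (E `&` (D `&` B t)) = (\int[P]_(w in D `&` B t) phi (Y w))%E) ->
  condp (B t) D @[t --> +oo] --> q ->
  condp (B t) (E `&` D) @[t --> +oo] --> l * q.
Proof.
move=> mB mE mD PB0 mphi mY phi01 l01 phil esc PE Dq.
have dist0 : l * condp (B t) D - condp (B t) (E `&` D) @[t --> +oo] --> 0.
  apply/cvgr0Pnorm_le => e e0.
  have e20 : 0 < e / 2 by rewrite divr_gt0.
  (* The threshold M is fixed first, from the convergence of phi; only then is t taken large enough
     for Y <= M to be unlikely. *)
  move/cvgrPdist_le : phil => /(_ _ e20)[M [_ Mphi]].
  have := esc M => /cvgr0Pnorm_le /(_ _ e20) h; near=> t.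
  apply: (@le_trans _ _ (e / 2 + condp (B t) [set w | Y w <= M])).
    apply: (@condp_kernel_dist _ _ _ (phi \o Y) Y) => //; last 2 first.
    - exact: ltW.
    - by move=> w Mw; exact: Mphi.
    by move=> w; exact: phi01.
  rewrite [leRHS]splitr lerD2l -(ger0_norm (condp_ge0 _ _)).
  by near: t; exact: h.
have -> : (fun t => condp (B t) (E `&` D)) = (fun t => l * condp (B t) D -
    (l * condp (B t) D - condp (B t) (E `&` D))).
  by apply/funext => t; rewrite subKr.
rewrite -[X in _ --> X]subr0; apply: cvgB => //.
by apply: cvgM => //; exact: cvg_cst.
Unshelve. all: by end_near. Qed.

End conditioning_step.

(** * Kernels escaping to infinity *)

Lemma pker_le1 (R : realType) d (S : measurableType d) d' (S' : measurableType d')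
    (K : R.-pker S ~> S') x A : measurable A -> (0 <= K x A <= 1)%E.
Proof.
move=> mA; apply/andP; split => //.
have <- : K x setT = 1%E by exact: prob_kernel.
by rewrite le_measure ?inE.
Qed.

Lemma pker_fine (R : realType) d (S : measurableType d) d' (S' : measurableType d')
    (K : R.-pker S ~> S') x A : measurable A -> (fine (K x A))%:E = K x A.
Proof.
move=> mA; have /andP[K0 K1] := pker_le1 K x mA.
by rewrite fineK// ge0_fin_numE// (le_lt_trans K1)// ltry.
Qed.

(** This union bound will involve only masses of lower orthants B and C, which weak convergence of
    distribution functions controls. *)
Lemma pker_fine_leUC (R : realType) d (S : measurableType d) d' (S' : measurableType d')
    (K : R.-pker S ~> S') x A B C :
  measurable A -> measurable B -> measurable C -> A `<=` B `|` ~` C ->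
  fine (K x A) <= fine (K x B) + (1 - fine (K x C)).
Proof.
move=> mA mB mC ABC; have mC' : measurable (~` C) by exact: measurableC.
have : (K x C + K x (~` C) = 1)%E.
  rewrite -measureU//; last by rewrite setICr.
  by rewrite setUv; exact: prob_kernel.
rewrite -(pker_fine K x mC) -(pker_fine K x mC') -EFinD => -[<-].
rewrite addrAC subrr add0r -lee_fin EFinD !pker_fine//.
apply: le_trans (measureU2 _ mB mC').
by rewrite le_measure ?inE//; exact: measurableU.
Qed.

Section kernel_escape.
Context (R : realType) (T : finType).

Lemma measurable_rvec_norm_le (r : R) :
  measurable [set y : rvec R T | forall i, `|y i| <= r].
Proof.
apply: (@measurable_rvec_le _ (rvec R T) R T (fun y i => `|y i|) (fun _ _ => r)) => i.
  by apply: measurableT_comp => //; exact: measurable_rvec_proj.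
exact: measurable_cst.
Qed.

(** The complements of growing cubes decrease to the empty set, so continuity from above applies. *)
Lemma rvec_tight (mu : probability (rvec R T) R) (e : R) : 0 < e ->
  exists n : nat, (mu (~` [set y | forall i, (`|y i| <= n%:R)%R]) <= e%:E)%E.
Proof.
move=> e0; pose A n := ~` [set y : rvec R T | forall i, `|y i| <= n%:R].
have mA n : measurable (A n).
  by apply: measurableC; exact: measurable_rvec_norm_le.
have A0 : \bigcap_n A n = set0.
  apply/seteqP; split => // y Ay.
  (* The sum of all the absolute values, rounded up, bounds every coordinate at once. *)
  apply: (Ay (Num.truncn (\sum_i `|y i|)).+1 I) => i.
  apply: le_trans (ltW (truncnS_gt _)).
  by rewrite (bigD1 i)//= lerDl sumr_ge0.
have : mu (A n) @[n --> \oo] --> mu (\bigcap_n A n).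
  apply: nonincreasing_cvg_mu => //.
  - by rewrite (le_lt_trans (probability_le1 _ _))// ltry.
  - exact: bigcap_measurable.
  - move=> m n mn; apply/subsetPset => y Any Amy; apply: Any => i.
    by rewrite (le_trans (Amy i))// ler_nat.
rewrite A0 measure0 => /fine_cvg /cvgr0Pnorm_le /(_ _ e0) [n _ /(_ n (leqnn n))].
move=> An; exists n; rewrite -/(A n) -(@fineK _ (mu (A n))) ?fin_num_measure//.
by rewrite lee_fin (le_trans (ler_norm _)).
Qed.

Lemma measurable_rescaled_le (a b z : rvec R T) :
  measurable [set y : rvec R T | forall w, (y w - a w) / b w <= z w].
Proof.
apply: (@measurable_rvec_le _ (rvec R T) R T
  (fun y w => (y w - a w) / b w) (fun _ => z)) => i; last exact: measurable_cst.
apply: measurable_funM => //; apply: measurable_funB => //.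
exact: measurable_rvec_proj.
Qed.

Variables (K : R.-pker (measurableTypeR R) ~> rvec R T) (a b : R -> rvec R T)
  (mu : probability (rvec R T) R).
Hypotheses (b_gt0 : forall t w, 0 < b t w)
  (ab_pinfty : forall (y : rvec R T) w, a t w + b t w * y w @[t --> +oo] --> +oo)
  (K_mu : weakly_cvg (fun t z => fine (K t
     [set y | forall w, (y w - a t w) / b t w <= z w])) (mcdf mu)).

(** For large t, y u <= M forces the renormalised coordinate u below -n, because a + b y exceeds M
    even for very negative y. By tightness the limit law puts little mass there. *)
Lemma kernel_escape u M : fine (K t [set y : rvec R T | y u <= M]) @[t --> +oo] --> 0.
Proof.
apply/cvgr0Pnorm_le => e e0.
have e40 : 0 < e / 4 by rewrite divr_gt0.
have [n tight] := rvec_tight mu e40.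
(* The orthant at [z true] contains the cube of radius n. The one at [z false] misses it even after
   a shift by c < 1, which is why the coordinate u is -(n+1) and not -n. *)
pose z (k : bool) : rvec R T :=
  if k then (fun=> n%:R) else (fun i => if i == u then - n.+1%:R else n%:R).
have [c /andP[c0 c1] cc] :=
  @mcdf_common_continuity_point R bool (fun=> T) (fun=> mu) z 1 ltr01.
pose S t k := [set y : rvec R T | forall w, (y w - a t w) / b t w <= rvec_shift (z k) c w].
have mS t k : measurable (S t k) by exact: measurable_rescaled_le.
have mM : measurable [set y : rvec R T | y u <= M].
  rewrite -[X in measurable X]setTI; apply: measurable_fun_le => //.
  exact: measurable_rvec_proj.
have mN : measurable (~` [set y : rvec R T | forall i, `|y i| <= n%:R]).
  by apply: measurableC; exact: measurable_rvec_norm_le.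
have zT : 1 - e / 4 <= mcdf mu (rvec_shift (z true) c).
  rewrite -lee_fin -mcdf_fin EFinB leeBlDr//.
  apply: le_trans (leeD (lexx _) tight).
  apply: le_trans (measureU2 _ _ mN); last exact: rvec_le_measurable.
  rewrite -(@probability_setT _ _ _ mu) le_measure ?inE//.
    by apply: measurableU => //; exact: rvec_le_measurable.
  move=> y _; have [yn|yn] := pselect (forall i, `|y i| <= n%:R); [left|by right].
  move=> i /=; rewrite /rvec_shift (le_trans (ler_norm _))// (le_trans (yn i))//.
  by rewrite lerDl ltW.
have zF : mcdf mu (rvec_shift (z false) c) <= e / 4.
  rewrite -lee_fin -mcdf_fin; apply: le_trans tight.
  rewrite le_measure ?inE//; first exact: rvec_le_measurable.
  move=> y /(_ u) + /(_ u); rewrite /rvec_shift/= eqxx -natr1 ler_norml => ? /andP[? _]; lra.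
have hT := K_mu (cc true); have hF := K_mu (cc false).
move/cvgrPdist_le : hT => /(_ _ e40) hT; move/cvgrPdist_le : hF => /(_ _ e40) hF.
have hM := @ab_pinfty (rvec_shift (z false) c) u.
move/cvgryPge : hM => /(_ M) hM.
near=> t.
(* The bound e is spent in four quarters: the two limit masses and the two errors of approximation
   by the kernel at t. *)
rewrite ger0_norm ?fine_ge0//.
have sub : [set y : rvec R T | y u <= M] `<=` S t false `|` ~` S t true.
  move=> y /= yM; have [yT|yT] := pselect (S t true y); [left|by right].
  move=> w; rewrite /rvec_shift/=; case: eqVneq => [->|_]; last exact: (yT w).
  rewrite ler_pdivrMr// lerBlDl (le_trans yM)// mulrC.
  have : M <= a t u + b t u * rvec_shift (z false) c u by near: t; exact: hM.
  by rewrite /rvec_shift/= eqxx.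
apply: (le_trans (pker_fine_leUC K t mM (mS _ _) (mS _ _) sub)).
have hTt : `|mcdf mu (rvec_shift (z true) c) - fine (K t (S t true))| <= e / 4.
  by near: t; exact: hT.
have hFt : `|mcdf mu (rvec_shift (z false) c) - fine (K t (S t false))| <= e / 4.
  by near: t; exact: hF.
move: hTt hFt; rewrite !ler_norml => /andP[? ?] /andP[? ?]; lra.
Unshelve. all: by end_near. Qed.

End kernel_escape.

(** * Finite product probability spaces *)

(** Induction on the list of indices, taking the product with one more factor each time. The maps Z
    i exist for all i, also off the list, which keeps the dependent family total. *)
Lemma finite_product_probability (R : realType) (I : choiceType) (d : measure_display)
    (T : I -> measurableType d) (mu : forall i, probability (T i) R) (r : seq I) :
  uniq r ->
  exists (d' : measure_display) (Omega : measurableType d')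
    (P : probability Omega R) (Z : forall i, Omega -> T i),
    (forall i, measurable_fun [set: Omega] (Z i)) /\
    forall B : forall i, set (T i), (forall i, measurable (B i)) ->
      P [set w | forall i, i \in r -> B i (Z i w)] =
      (\prod_(i <- r) mu i (B i))%E.
Proof.
elim: r => [_|j r ih /= /andP[jr ur]].
  (* A space carrying a probability is inhabited; the chosen points serve as constant values for
     indices off the list. *)
  have point i : T i.
    suff /cid[x _] : [set: T i] !=set0 by exact: x.
    apply/set0P/eqP => T0; have := @probability_setT _ _ _ (mu i).
    by rewrite T0 measure0 => /eqP; rewrite eqe eq_sym oner_eq0.
  exists _, unit, \d_tt, (fun i _ => point i); split=> [i|B mB].
    exact: measurable_cst.
  rewrite big_nil (_ : [set w | _] = setT) ?probability_setT//.
  by apply/seteqP; split.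
have [d2 [S [P [Z [mZ PZ]]]]] := ih ur.
(* The new coordinate is transported along j = i; every other one is read from the old space. *)
pose Z' i (w : S * T j) : T i :=
  match j =P i with
  | ReflectT e => eq_rect j (fun k => T k) w.2 i e
  | ReflectF _ => Z i w.1
  end.
have Z'j w : Z' j w = w.2.
  by rewrite /Z'; case: eqP => // e; rewrite (eq_axiomK e).
have Z'n i w : i != j -> Z' i w = Z i w.1.
  by move=> ij; rewrite /Z'; case: eqP => // e; rewrite e eqxx in ij.
exists _, (S * T j)%type, (P \x mu j)%E, Z'; split=> [i|B mB].
  have [->|ij] := eqVneq i j.
    by rewrite (_ : Z' j = snd)//; apply/funext => w; rewrite Z'j.
  rewrite (_ : Z' i = Z i \o fst); first exact: measurableT_comp.
  by apply/funext => w; rewrite Z'n.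
rewrite big_cons -PZ// muleC -product_measure1E//; last first.
  rewrite (_ : [set w | _] = \big[setI/setT]_(i <- r) (Z i @^-1` B i)).
    apply: bigsetI_measurable => i _; rewrite -[X in measurable X]setTI.
    exact: (mZ i measurableT _ (mB i)).
  by rewrite -bigcap_seq; apply/seteqP; split.
congr ((P \x mu j)%E _); apply/seteqP; split=> [w Bw|w [/= Zw Bw] i].
  split=> [i ir|]; last by rewrite -Z'j; apply: Bw; rewrite mem_head.
  rewrite -Z'n; first by apply: Bw; rewrite in_cons ir orbT.
  by apply: contraNneq jr => <-.
rewrite in_cons; case: (eqVneq i j) => [-> _|ij /=]; first by rewrite Z'j.
by rewrite Z'n//; exact: Zw.
Qed.

Lemma exists_independent_family (R : realType) (I : finType)
    (d : measure_display) (T : I -> measurableType d)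
    (mu : forall i, probability (T i) R) :
  exists (d' : measure_display) (Omega : measurableType d')
    (P : probability Omega R) (Z : forall i, {RV P >-> T i}),
    (forall i B, measurable B -> distribution P (Z i) B = mu i B) /\
    mutual_indep P (fun i => Z i : Omega -> T i).
Proof.
have [d' [S [P [Z [mZ PZ]]]]] := finite_product_probability mu (index_enum_uniq I).
have PJ (J : {set I}) (B : forall i, set (T i)) : (forall i, measurable (B i)) ->
    P [set w | forall i, i \in J -> B i (Z i w)] = (\prod_(i in J) mu i (B i))%E.
  move=> mB; rewrite big_mkcond/=.
  (* Indices outside J are given the whole space, of mass 1. *)
  transitivity (\prod_i mu i (if i \in J then B i else setT))%E; last first.
    by apply: eq_bigr => i _; case: ifP => // _; rewrite probability_setT.
  rewrite -PZ; last by move=> i; case: ifP.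
  congr (P _); apply/seteqP; split=> w h i.
    by case: ifPn => [iJ _|//]; exact: h.
  by move=> iJ; have := h i (mem_index_enum i); rewrite iJ.
have law i (B : set (T i)) : measurable B -> P (Z i @^-1` B) = mu i B.
  move=> mB.
  (* The law of one coordinate is the case J = {i}, with B completed to a family by whole spaces. *)
  pose B' j : set (T j) := match i =P j with
    | ReflectT e => eq_rect i (fun k => set (T k)) B j e
    | ReflectF _ => setT
    end.
  have B'i : B' i = B by rewrite /B'; case: eqP => // e; rewrite (eq_axiomK e).
  have mB' j : measurable (B' j).
    rewrite /B'; case: eqP => [e|_]; last exact: measurableT.
    by case: j / e.
  have := PJ [set i]%SET B' mB'; rewrite big_set1 B'i => <-.
  congr (P _); apply/seteqP; split=> [w h j|w h].
    by rewrite inE => /eqP ->; rewrite B'i.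
  by rewrite /= -B'i; apply: h; rewrite inE.
exists d', S, P, (fun i => mfun_Sub (mem_set (mZ i))); split=> [i B mB|J B mB].
  exact: law.
by rewrite PJ//; apply: eq_bigr => i _; rewrite law.
Qed.

(** * Propagation along the cliques *)

Section sigma_gen.
Context d (Omega : measurableType d) d1 (T1 : measurableType d1)
  d2 (T2 : measurableType d2).

Lemma sigma_gen_setI (Z : Omega -> T1) D1 D2 :
  sigma_gen Z D1 -> sigma_gen Z D2 -> sigma_gen Z (D1 `&` D2).
Proof.
move=> [B1 mB1 <-] [B2 mB2 <-]; exists (B1 `&` B2); first exact: measurableI.
by rewrite preimage_setI setIIr.
Qed.

Lemma sigma_gen_preimage (Z : Omega -> T1) (g : T1 -> T2) B :
  measurable_fun [set: T1] g -> measurable B ->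
  sigma_gen Z ((g \o Z) @^-1` B).
Proof.
move=> mg mB; exists (g @^-1` B); last by rewrite setTI.
by rewrite -[X in measurable X]setTI; exact: mg.
Qed.

End sigma_gen.

(** The kernel sees Z only through g(Z). Events of g(Z) lie in the sigma-algebra of Z, so the
    rectangle case is the defining property of the conditional law. *)
Lemma cond_law_integral d (Omega : measurableType d) (R : realType)
    (P : probability Omega R) d1 (T1 : measurableType d1)
    d2 (T2 : measurableType d2) d3 (T3 : measurableType d3)
    (Z : Omega -> T1) (g : T1 -> T2) (W : Omega -> T3)
    (K : R.-pker T2 ~> T3) :
  measurable_fun [set: Omega] Z -> measurable_fun [set: T1] g ->
  measurable_fun [set: Omega] W ->
  cond_law P (sigma_gen Z) W (fun w => K (g (Z w))) ->
  forall D, sigma_gen Z D -> forall S, measurable S ->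
    P ((fun w => (g (Z w), W w)) @^-1` S `&` D) =
    (\int[P]_(w in D) K (g (Z w)) (xsection S (g (Z w))))%E.
Proof.
move=> mZ mg mW claw D ZD S mS.
apply: (@integral_kernel_section _ _ _ P _ _ _ _ K (g \o Z) W) => //.
- exact: measurableT_comp.
- by case: ZD => B mB <-; exact: mZ.
- move=> A B mA mB; have [_ _ ->] := claw B mB => //.
  by apply: sigma_gen_setI => //; exact: sigma_gen_preimage.
Qed.

Section block_model.
Context (R : realType) disp (Omega : measurableType disp)
  (P : probability Omega R) (d : nat) (e : rel 'I_d) (v : 'I_d)
  (n : nat) (C : 'I_n.+1 -> {set 'I_d}) (s : 'I_n.+1 -> 'I_d)
  (X : 'I_d -> {RV P >-> R}) (K : kernels R d) (a b : normings R d)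
  (G : forall (A : {set 'I_d}) (u : 'I_d), probability (subvec R (A :\ u)) R).
Hypotheses (C_rip : rip_ordering e C) (v_C : v \in C ord0) (s_0 : s ord0 = v)
  (s_sep : forall i, i != ord0 -> separator C i = [set s i]%SET)
  (K_law : transition_kernels e X K) (X_model : graphical_model e X K C s)
  (A0 : assumption_A0 X) (B1 : assumption_B1 e K a b G).

Arguments a : clear implicits.
Arguments b : clear implicits.
Arguments G : clear implicits.

Lemma coords_measurable (A : {set 'I_d}) :
  measurable_fun [set: Omega] (coords X A).
Proof. by apply: measurable_fun_rvec => u; exact: measurable_funPT. Qed.

Lemma max_clique_C i : max_clique e (C i).
Proof. by case: C_rip => _ /(_ (C i)) [_ ->] //; exists i. Qed.

Lemma separator_vertex i : s i \in C i.
Proof.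
have [->|i0] := eqVneq i ord0; first by rewrite s_0.
have : s i \in separator C i by rewrite s_sep// set11.
by rewrite inE => /andP[].
Qed.

Lemma separator_predecessor i : i != ord0 -> s i \in predecessors C i.
Proof.
move=> i0; have : s i \in separator C i by rewrite s_sep// set11.
by rewrite inE => /andP[].
Qed.

Lemma clique_sub_predecessors (i j : 'I_n.+1) : (j < i)%N ->
  C j \subset predecessors C i.
Proof. by move=> ji; apply/fintype.subsetP => u uj; apply/bigcupP; exists j. Qed.

Definition exceed (t : R) : set Omega := [set w | t < X v w].

Lemma exceedE t : exceed t = X v @^-1` [set` `]t, +oo[].
Proof. by apply/seteqP; split => w; rewrite /exceed/= in_itv/= andbT. Qed.

Lemma exceed_measurable t : measurable (exceed t).
Proof. by rewrite exceedE; exact: measurable_funPTI. Qed.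

Lemma rv_le_measurable u M : measurable [set w | X u w <= M].
Proof.
have -> : [set w | X u w <= M] = X u @^-1` [set` `]-oo, M]].
  by apply/seteqP; split => w; rewrite /= in_itv.
exact: measurable_funPTI.
Qed.

Lemma exceed_gt0 t : (0 < P (exceed t))%E.
Proof.
have -> : exceed t = ~` [set w | X v w <= t].
  by apply/seteqP; split => w /=; rewrite /exceed/= ltNge => /negP.
have m := rv_le_measurable v t.
rewrite probability_setC// A0 -EFinB lte_fin subr_gt0 gt_max ltr01/=.
by rewrite gtrBl expR_gt0.
Qed.

(* The sigma-algebra given which the model prescribes the law of block i. *)
Definition past (i : 'I_n.+1) : set (set Omega) :=
  if i == ord0 then sigma_gen (X v) else sigma_gen (coords X (predecessors C i)).

Lemma past_setI i D1 D2 : past i D1 -> past i D2 -> past i (D1 `&` D2).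
Proof. by rewrite /past; case: ifP => _; exact: sigma_gen_setI. Qed.

Lemma past_coord i u B : i != ord0 -> u \in predecessors C i -> measurable B ->
  past i (X u @^-1` B).
Proof.
move=> i0 ui mB; rewrite /past (negbTE i0).
pose p := exist (fun u : 'I_d => u \in predecessors C i) u ui.
exists ((fun y : subvec R (predecessors C i) => y p) @^-1` B).
  by rewrite -[X in measurable X]setTI; exact: measurable_rvec_proj.
by rewrite setTI.
Qed.

(** The conditioning event concerns a vertex of the first clique, so it belongs to every past and
    can be included in the domain of disintegration. *)
Lemma past_exceed i t : past i (exceed t).
Proof.
have mB : measurable [set` `]t, +oo[] by exact: measurable_itv.
rewrite exceedE.
have [->|i0] := eqVneq i ord0; last first.
  apply: past_coord => //.
  have /fintype.subsetP : C ord0 \subset predecessors C i.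
    by apply: clique_sub_predecessors; rewrite lt0n.
  exact.
rewrite /past eqxx.
by exists [set` `]t, +oo[] => //; rewrite setTI.
Qed.

(** For the first block the past is generated by X_v alone and [K_law] applies; for later ones the
    Markov clause of the model reduces the past to X_(s_i). *)
Lemma past_kernel i D : past i D ->
  forall S : set (measurableTypeR R * subvec R (C i :\ s i)), measurable S ->
  P ((fun w => (X (s i) w, coords X (C i :\ s i) w)) @^-1` S `&` D) =
  (\int[P]_(w in D) K (C i) (s i) (X (s i) w) (xsection S (X (s i) w)))%E.
Proof.
rewrite /past; have [->|i0] := eqVneq i ord0 => pD S mS.
  apply: (@cond_law_integral _ _ _ P _ (measurableTypeR R) _ (measurableTypeR R)
    _ _ (X (s ord0)) id) => //.
  - by move=> _ B mB; rewrite setTI; exact: (measurable_funPTI (X (s ord0))).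
  - exact: coords_measurable.
  - by apply: K_law; [exact: max_clique_C|exact: separator_vertex].
  - by rewrite s_0.
have si := separator_predecessor i0.
apply: (@cond_law_integral _ _ _ P _ _ _ (measurableTypeR R) _ _
    (coords X (predecessors C i)) (fun y => y (exist _ (s i) si))) => //.
- exact: coords_measurable.
- exact: measurable_rvec_proj.
- exact: coords_measurable.
- by case: X_model => _ /(_ i i0)[].
Qed.

Lemma kernel_clique_escape i (u : {u | u \in C i :\ s i}) M :
  fine (K (C i) (s i) t [set y | y u <= M]) @[t --> +oo] --> 0.
Proof.
have [_ b0 ab _ KG] := B1 (max_clique_C i) (separator_vertex i).
exact: (kernel_escape b0 ab KG).
Qed.

Lemma coord_measurable_le (i : 'I_n.+1) (u : {u | u \in C i :\ s i}) M :
  measurable [set y : subvec R (C i :\ s i) | y u <= M].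
Proof.
rewrite -[X in measurable X]setTI; apply: measurable_fun_le => //.
exact: measurable_rvec_proj.
Qed.

(** Strong induction on i: the separator vertex is v or lies in an earlier clique, hence escapes,
    and the kernel carries the escape to the rest of the clique. *)
Lemma clique_escape (i : 'I_n.+1) (u : 'I_d) M : u \in C i ->
  condp P (exceed t) [set w | X u w <= M] @[t --> +oo] --> 0.
Proof.
have [m] := ubnP (i : nat); elim: m => // m ih in i u M *; rewrite ltnS => im uC.
have esc_s N : condp P (exceed t) [set w | X (s i) w <= N] @[t --> +oo] --> 0.
  have [i0|i0] := eqVneq i ord0.
    (* Here s i is v, and X_v <= N is incompatible with X_v > t once t >= N. *)
    apply/cvgr0Pnorm_le => r r0; near=> t.
    rewrite /condp (_ : _ `&` _ = set0) ?measure0 ?mul0r ?normr0 ?ltW//.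
    apply/seteqP; split => // w []; rewrite /exceed/= i0 s_0 => XN tX.
    have : N <= t by near: t; apply: nbhs_pinfty_ge; exact: num_real.
    by move=> /(le_trans XN); rewrite leNgt tX.
  have /bigcupP[k ki sk] := separator_predecessor i0.
  by apply: (ih k _ N) => //; exact: leq_trans ki im.
have [->|us] := eqVneq u (s i); first exact: esc_s.
have uCs : u \in C i :\ s i by rewrite !inE us.
pose u' : {u | u \in C i :\ s i} := exist _ u uCs.
have := @condp_kernel_cvg _ _ _ P exceed [set w | X u w <= M] setT
  (fun x => K (C i) (s i) x [set y | y u' <= M]) (X (s i)) 0 1.
rewrite setIT mul0r; apply => //.
- exact: exceed_measurable.
- exact: rv_le_measurable.
- exact: exceed_gt0.
- move=> _ B mB.
  have := measurable_kernel (K (C i) (s i)) _ (coord_measurable_le u' M) measurableT B mB.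
  rewrite setTI => mKB; rewrite setTI; exact: (measurable_funPTI (X (s i)) mKB).
- by move=> x; apply: pker_le1; exact: coord_measurable_le.
- by rewrite lexx ler01.
- exact: kernel_clique_escape.
- move=> t; rewrite setTI.
  pose S := [set p : measurableTypeR R * subvec R (C i :\ s i) | p.2 u' <= M].
  have mS : measurable S.
    rewrite (_ : S = snd @^-1` [set y | y u' <= M])//.
    rewrite -[X in measurable X]setTI; apply: measurable_snd => //.
    exact: coord_measurable_le.
  rewrite (past_kernel (past_exceed i t) mS); apply: eq_integral => w _.
  by rewrite xsectionE.
- apply/cvgrPdist_le => r r0; near=> t.
  rewrite /condp setTI divff ?subrr ?normr0 ?ltW//.
  rewrite gt_eqF// fine_gt0// exceed_gt0/=.
  by rewrite (le_lt_trans (probability_le1 _ (exceed_measurable _)))// ltry.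
Unshelve. all: by end_near. Qed.

(** * Events of the renormalised blocks and their joint limit *)

Definition block_event (i : 'I_n.+1) (z : subvec R (C i :\ s i)) : set Omega :=
  [set w | forall u, (X (val u) w - a (C i) (s i) (X (s i) w) u) /
                     b (C i) (s i) (X (s i) w) u <= z u].

(** The section of this set at x is the event whose kernel mass converges in [assumption_B1]. *)
Definition block_set (i : 'I_n.+1) (z : subvec R (C i :\ s i)) :
    set (measurableTypeR R * subvec R (C i :\ s i)) :=
  [set p | forall u, (p.2 u - a (C i) (s i) p.1 u) / b (C i) (s i) p.1 u <= z u].

Lemma block_set_measurable i (z : subvec R (C i :\ s i)) :
  measurable (block_set z).
Proof.
have [[ma mb] b0 _ _ _] := B1 (max_clique_C i) (separator_vertex i).
have mpr u : measurable_fun [set: measurableTypeR R * subvec R (C i :\ s i)]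
    (fun p => p.2 u).
  by apply: (measurableT_comp (@measurable_rvec_proj _ _ u)).
have mcomp (f : R -> subvec R (C i :\ s i)) u : measurable_fun [set: R] f ->
    measurable_fun [set: measurableTypeR R * subvec R (C i :\ s i)]
    (fun p => f p.1 u).
  move=> mf _ B mB.
  have mfB : measurable (f @^-1` ((fun y : rvec R _ => y u) @^-1` B)).
    rewrite -[X in measurable X]setTI; apply: mf => //.
    by rewrite -[X in measurable X]setTI; exact: measurable_rvec_proj.
  exact: (@measurable_fst _ _ (measurableTypeR R) _ measurableT _ mfB).
(* Multiplying out b > 0 avoids the measurability of the inverse. *)
rewrite (_ : block_set z = [set p | forall u,
    p.2 u <= a (C i) (s i) p.1 u + z u * b (C i) (s i) p.1 u]).
  apply: (@measurable_rvec_le _ _ _ _ (fun p => p.2)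
    (fun p u => a (C i) (s i) p.1 u + z u * b (C i) (s i) p.1 u)) => // u.
  by apply: measurable_funD; [exact: mcomp|apply: measurable_funM => //; exact: mcomp].
by apply/seteqP; split => p h u; have := h u; rewrite ler_pdivrMr// lerBlDl.
Qed.

Lemma block_eventE i (z : subvec R (C i :\ s i)) : block_event z =
  (fun w => (X (s i) w : measurableTypeR R, coords X (C i :\ s i) w)) @^-1` block_set z.
Proof. by []. Qed.

Lemma block_event_past (i j : 'I_n.+1) (z : subvec R (C j :\ s j)) : (j < i)%N ->
  past i (block_event z).
Proof.
move=> ji; have i0 : i != ord0 by rewrite -lt0n (leq_ltn_trans _ ji).
rewrite /past (negbTE i0) block_eventE.
have /fintype.subsetP sub := clique_sub_predecessors ji.
have sub' u : u \in C j :\ s j -> u \in predecessors C i.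
  by rewrite inE => /andP[_ /sub].
pose q (u : {u | u \in C j :\ s j}) := exist (fun u : 'I_d => u \in predecessors C i)
  (val u) (sub' (val u) (valP u)).
pose p := exist (fun u : 'I_d => u \in predecessors C i) (s j)
  (sub (s j) (separator_vertex j)).
(* Block j is a function of the predecessors of i alone: g reads off the separator vertex and the
   rest of C_j. *)
pose g (y : subvec R (predecessors C i)) :
  measurableTypeR R * subvec R (C j :\ s j) := (y p, fun u => y (q u)).
apply: (@sigma_gen_preimage _ _ _ _ _ _ (coords X (predecessors C i)) g).
  apply: measurable_fun_pair; first exact: measurable_rvec_proj.
  by apply: measurable_fun_rvec => u; exact: measurable_rvec_proj.
exact: block_set_measurable.
Qed.

Lemma block_event_measurable i (z : subvec R (C i :\ s i)) :
  measurable (block_event z).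
Proof.
rewrite block_eventE -[X in measurable X]setTI.
have mX : measurable_fun [set: Omega] (X (s i) : Omega -> measurableTypeR R).
  by move=> _ B mB; rewrite setTI; exact: (measurable_funPTI (X (s i))).
have := measurable_fun_pair mX (@coords_measurable (C i :\ s i)).
by apply => //; exact: block_set_measurable.
Qed.

Variable z : forall i, subvec R (C i :\ s i).
Arguments z : clear implicits.

(** The natural number m counts blocks, so the induction starts from the empty intersection at 0 and
    reaches all of them at n+1. *)
Definition blocks_event (m : nat) : set Omega :=
  [set w | forall i : 'I_n.+1, (i < m)%N -> block_event (z i) w].

Lemma blocks_eventS (i : 'I_n.+1) :
  blocks_event i.+1 = block_event (z i) `&` blocks_event i.
Proof.
apply/seteqP; split => [w h|w [h1 h2] j].
  by split=> [|j ji]; apply: h => //; exact: leqW.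
rewrite ltnS leq_eqVlt => /predU1P[/val_inj->//|]; exact: h2.
Qed.

Lemma blocks_event0 : blocks_event 0 = setT.
Proof. by apply/seteqP; split. Qed.

Lemma blocks_event_measurable m : measurable (blocks_event m).
Proof.
rewrite (_ : blocks_event m =
  \bigcap_(i in [set i : 'I_n.+1 | (i < m)%N]) block_event (z i)).
  apply: fin_bigcap_measurable => // i _; exact: block_event_measurable.
by apply/seteqP; split.
Qed.

Lemma blocks_event_past (i : 'I_n.+1) m t : (m <= i)%N ->
  past i (blocks_event m `&` exceed t).
Proof.
elim: m => [_|m ih mi]; first by rewrite blocks_event0 setTI; exact: past_exceed.
pose j : 'I_n.+1 := Ordinal (ltn_trans mi (ltn_ord i)).
rewrite -[m.+1]/(j.+1) blocks_eventS -setIA; apply: past_setI.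
  exact: block_event_past.
by apply: ih; exact: ltnW.
Qed.

Lemma blocks_event_cvg :
  (forall i, {for z i, continuous (mcdf (G (C i) (s i)))}) ->
  forall m, (m <= n.+1)%N ->
  condp P (exceed t) (blocks_event m) @[t --> +oo] -->
  \prod_(i < n.+1 | (i < m)%N) mcdf (G (C i) (s i)) (z i).
Proof.
move=> zc; elim=> [_|m ih mn].
  rewrite big_pred0// blocks_event0.
  apply/cvgrPdist_le => r r0; near=> t.
  rewrite /condp setTI divff ?subrr ?normr0 ?ltW//.
  rewrite gt_eqF// fine_gt0// exceed_gt0/=.
  by rewrite (le_lt_trans (probability_le1 _ (exceed_measurable _)))// ltry.
pose i : 'I_n.+1 := Ordinal mn.
have -> : \prod_(j < n.+1 | (j < m.+1)%N) mcdf (G (C j) (s j)) (z j) =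
    mcdf (G (C i) (s i)) (z i) *
    \prod_(j < n.+1 | (j < m)%N) mcdf (G (C j) (s j)) (z j).
  (* Removing j = m from j < m+1 leaves j < m. *)
  rewrite (bigD1 i)//=; congr (_ * _); apply: eq_bigl => j.
  by rewrite ltnS [RHS]ltn_neqAle andbC.
rewrite -[m.+1]/(i.+1) blocks_eventS.
have mS := block_set_measurable (z i).
have mKS x : measurable (xsection (block_set (z i)) x) by exact: measurable_xsection.
have [_ _ _ _ KG] := B1 (max_clique_C i) (separator_vertex i).
apply: (@condp_kernel_cvg _ _ _ P exceed (block_event (z i)) (blocks_event i)
  (fun x => K (C i) (s i) x (xsection (block_set (z i)) x)) (X (s i))) => //.
- exact: exceed_measurable.
- exact: block_event_measurable.
- exact: blocks_event_measurable.
- exact: exceed_gt0.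
- apply: (@measurable_kernel_section _ _ _ _ (measurableTypeR R)) => //.
  by move=> _ B mB; rewrite setTI; exact: (measurable_funPTI (X (s i))).
- by move=> x; apply: pker_le1; exact: mKS.
- apply/andP; split; first by rewrite fine_ge0.
  by rewrite -lee_fin -mcdf_fin; exact: probability_le1 (rvec_le_measurable _).
- apply: cvg_trans (KG _ (zc i)); apply: near_eq_cvg; near=> t.
  by rewrite xsectionE.
- by move=> M; apply: clique_escape; exact: separator_vertex.
- move=> t; rewrite block_eventE; apply: past_kernel => //.
  exact: blocks_event_past.
- exact: ih (ltnW mn).
Unshelve. all: by end_near. Qed.

End block_model.

(** * Convergence to the independent limit vectors *)

Theorem theorem2 (R : realType) (disp : measure_display)
    (Omega : measurableType disp) (P : probability Omega R)
    (d : nat) (e : rel 'I_d) (e_sym : symmetric e) (e_irr : irreflexive e)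
    (e_block : block_graph e) (v : 'I_d)
    (n : nat) (C : 'I_n.+1 -> {set 'I_d}) (C_rip : rip_ordering e C)
    (v_C : v \in C ord0)
    (s : 'I_n.+1 -> 'I_d) (s_0 : s ord0 = v)
    (s_sep : forall i, i != ord0 -> separator C i = [set s i]%SET)
    (X : 'I_d -> {RV P >-> R}) (K : kernels R d)
    (K_law : transition_kernels e X K)
    (X_model : graphical_model e X K C s)
    (a b : normings R d)
    (G : forall (A : {set 'I_d}) (u : 'I_d), probability (subvec R (A :\ u)) R)
    (A0 : assumption_A0 X) (B1 : assumption_B1 e K a b G) :
  exists (disp' : measure_display) (Omega' : measurableType disp')
    (P' : probability Omega' R)
    (Z : forall i, {RV P' >-> subvec R (C i :\ s i)}),
    [/\ forall i B, measurable B -> distribution P' (Z i) B = G (C i) (s i) B,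
        mutual_indep P' (fun i => Z i : Omega' -> subvec R (C i :\ s i))
      & weakly_cvg
          (fun t => cond_cdf P [set w | t < X v w] (normalised X a b C s))
          (mcdf (pushforward P' (fun w => concat (fun i => Z i w))))].
Proof.
have [d' [S [P' [Z [lawZ indZ]]]]] :=
  exists_independent_family (fun i => G (C i) (s i)).
exists d', S, P', Z; split=> //.
pose H := mcdf (pushforward P' (fun w => concat (fun i => Z i w))).
(* By independence the limiting distribution function factors over the blocks at every corner. *)
have HE (z : forall i, subvec R (C i :\ s i)) :
    H (concat z) = \prod_i mcdf (G (C i) (s i)) (z i).
  pose B i := [set y : subvec R (C i :\ s i) | forall u, y u <= z i u].
  have mB i : measurable (B i) by exact: rvec_le_measurable.
  have PB : P' ((fun w => concat (fun i => Z i w)) @^-1`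
      [set y | forall p, y p <= concat z p]) =
      (\prod_i (mcdf (G (C i) (s i)) (z i))%:E)%E.
    transitivity (\prod_(i in [set: 'I_n.+1]%SET) P' (Z i @^-1` B i))%E.
      rewrite -indZ//; congr (P' _).
      apply/seteqP; split=> [w h i _ u|w h [i u]]; first exact: (h (existT _ i u)).
      by apply: (h i); rewrite inE.
    apply: eq_big => [i|i _]; first by rewrite inE.
    by rewrite -mcdf_fin -lawZ; last exact: mB.
  by rewrite /H /mcdf /pushforward PB prodEFin.
pose block (z : rvec R {i : 'I_n.+1 & {u : 'I_d | u \in C i :\ s i}}) i :
    subvec R (C i :\ s i) := fun u : {u | u \in C i :\ s i} => z (existT _ i u).
have eventE z : [set w | forall p, normalised X a b C s w p <= z p] =
    blocks_event X a b (block z) n.+1.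
  apply/seteqP; split=> [w h i _ u|w h [i u]]; first exact: (h (existT _ i u)).
  exact: (h i (ltn_ord i) u).
have mevent z : measurable [set w | forall p, normalised X a b C s w p <= z p].
  rewrite eventE; exact: (blocks_event_measurable X C_rip v_C s_0 s_sep B1).
apply: (@weakly_cvg_shift _ _ _ H) => [t z z' zz'|z r r0].
  apply: condp_le => //; first exact: exceed_measurable.
  by move=> w h p; exact: le_trans (h p) (zz' p).
(* One shift c serves all blocks, so each factor is continuous at its shifted corner, as
   [blocks_event_cvg] requires. *)
have [c cr cc] := mcdf_common_continuity_point (fun i => G (C i) (s i)) (block z) r0.
exists c => //.
have -> : rvec_shift z c = concat (fun i => rvec_shift (block z i) c).
  by apply/funext => -[i u].
rewrite HE (eq_bigl (fun i : 'I_n.+1 => (i < n.+1)%N)); last first.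
  by move=> i; rewrite ltn_ord.
have := blocks_event_cvg C_rip v_C s_0 s_sep K_law X_model A0 B1 cc (leqnn _).
apply: cvg_trans; apply: near_eq_cvg; apply: nearW => t.
by rewrite /cond_cdf eventE.
Qed.
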